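(* Let $\mathcal{X}\subseteq\mathbb{R}^n$ be a nonempty compact set, let $\phi:\mathbb{R}^n\to\mathbb{R}$ (risk) and $R:\mathbb{R}^n\to\mathbb{R}$ (reward), and let $\beta(\cdot)$, $\alpha(\cdot)$, $\underline{b}$, $\bar a$ be defined as in the context. Let $I\subseteq[\alpha(\underline{b}),\bar a]$ be an interval. Then the relation $a=\alpha(\beta(a))$ holds for every $a\in I$ if and only if $\beta$ is strictly increasing on $I$.
   Context: For $a,b\in\mathbb{R}$ define $$\beta(a)=\min\{\phi(x): R(x)\ge a,\ x\in\mathcal{X}\},\qquad \alpha(b)=\max\{R(x): \phi(x)\le b,\ x\in\mathcal{X}\},$$ with the convention $\beta(a)=+\infty$ (resp. $\alpha(b)=-\infty$) if the corresponding problem is infeasible. Define also $$\underline{b}=\min\{\phi(x): x\in\mathcal{X}\},\qquad \bar a=\max\{R(x): x\in\mathcal{X}\}.$$ All these minima and maxima are understood to be attained whenever the corresponding problem is feasible. The functions $\phi$ and $R$ are not assumed to be convex or concave.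
   Formalization: The direction ''β strictly increasing on I implies a = α(β(a)) on I'' is stated only when the greatest element of I, if any, equals ā; otherwise it fails, e.g. X=[0,2], R(x)=x, φ(x)=min(x,1), I=[0,1], where α(β(1))=2. *)

(* Defs.v *)
From HB Require Import structures.
From mathcomp Require Import all_boot all_order all_algebra.
From mathcomp Require Import all_classical all_reals all_analysis.
Set Implicit Arguments.
Unset Strict Implicit.
Unset Printing Implicit Defensive.
Import Order.TTheory GRing.Theory Num.Theory.
Import numFieldNormedType.Exports.
Local Open Scope classical_set_scope.
Local Open Scope ring_scope.

Definition attains_min (R : realType) (T : Type) (f : T -> R) (A : set T) : Prop :=
  exists2 x, A x & forall y, A y -> f x <= f y.

Definition attains_max (R : realType) (T : Type) (f : T -> R) (A : set T) : Prop :=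
  exists2 x, A x & forall y, A y -> f y <= f x.

Section RiskReward.
Variables (R : realType) (n : nat).
Variables (X : set 'rV[R]_n) (phi rew : 'rV[R]_n -> R).

Definition reward_feasible (a : R) : set 'rV[R]_n :=
  [set x | X x /\ a <= rew x].

Definition risk_feasible (b : R) : set 'rV[R]_n :=
  [set x | X x /\ phi x <= b].

Definition optima_attained : Prop :=
  [/\ forall a, reward_feasible a !=set0 -> attains_min phi (reward_feasible a),
      forall b, risk_feasible b !=set0 -> attains_max rew (risk_feasible b),
      X !=set0 -> attains_min phi X
    & X !=set0 -> attains_max rew X].

(* Under [optima_attained], the infima and suprema below are minima and maxima;
   [ereal_inf set0 = +oo] and [ereal_sup set0 = -oo] give the values of the
   infeasible problems. *)
Definition beta (a : R) : \bar R :=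
  ereal_inf [set (phi x)%:E | x in reward_feasible a].

Definition alpha (b : R) : \bar R :=
  ereal_sup [set (rew x)%:E | x in risk_feasible b].

Definition min_risk : R := inf (phi @` X).

Definition max_reward : R := sup (rew @` X).

End RiskReward.

Definition strictly_increasing_on (R : realType) (f : R -> \bar R) (I : set R) :
    Prop :=
  forall a a', I a -> I a' -> a < a' -> (f a < f a')%E.

(* [alpha] takes a real argument, hence [fine]: [beta a] is finite as soon as
   [a <= max_reward X rew] and the optima are attained. *)
Definition frontier_identity_on (R : realType) (n : nat) (X : set 'rV[R]_n)
    (phi rew : 'rV[R]_n -> R) (I : set R) : Prop :=
  forall a, I a -> a%:E = alpha X phi rew (fine (beta X phi rew a)).

(* Main.v *)
(** [beta] is nondecreasing and, for feasible [a], the point realising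
[alpha (beta a)] has reward [a* >= a] and risk [beta a]. Hence [beta] is
constant on [[a, a*]], so strict increase to the right of [a] forces [a* = a]. *)

Require Import Defs.
From HB Require Import structures.
From mathcomp Require Import all_boot all_order all_algebra.
From mathcomp Require Import all_classical all_reals all_analysis.
Import Order.TTheory GRing.Theory Num.Theory.
Import numFieldNormedType.Exports.
Local Open Scope classical_set_scope.
Local Open Scope ring_scope.

Lemma ereal_inf_attained (R : realType) (T : Type) (f : T -> R) (A : set T) x :
  A x -> (forall y, A y -> f x <= f y) ->
  ereal_inf [set (f y)%:E | y in A] = (f x)%:E.
Proof.
move=> Ax fx_min; apply/eqP; rewrite eq_le; apply/andP; split.
  by apply: ereal_inf_lbound; exists x.
by apply: le_ereal_inf_tmp => _ [y Ay <-]; rewrite lee_fin; apply: fx_min.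
Qed.

Lemma ereal_sup_attained (R : realType) (T : Type) (f : T -> R) (A : set T) x :
  A x -> (forall y, A y -> f y <= f x) ->
  ereal_sup [set (f y)%:E | y in A] = (f x)%:E.
Proof.
move=> Ax fx_max; apply/eqP; rewrite eq_le; apply/andP; split.
  by apply: ge_ereal_sup => _ [y Ay <-]; rewrite lee_fin; apply: fx_max.
by apply: ereal_sup_ubound; exists x.
Qed.

Lemma sup_attained (R : realType) (T : Type) (f : T -> R) (A : set T) x :
  A x -> (forall y, A y -> f y <= f x) -> sup (f @` A) = f x.
Proof.
move=> Ax fx_max; apply/eqP; rewrite eq_le; apply/andP; split.
  by apply: ge_sup => [|_ [y Ay <-]]; [exists (f x); exists x | apply: fx_max].
by apply: ub_le_sup; [exists (f x) => _ [y Ay <-]; apply: fx_max | exists x].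
Qed.

Lemma beta_le (R : realType) (n : nat) (X : set 'rV[R]_n)
    (phi rew : 'rV[R]_n -> R) (a a' : R) :
  a <= a' -> (beta X phi rew a <= beta X phi rew a')%E.
Proof.
move=> le_aa'; apply: ereal_inf_le_tmp => _ [x [Xx a'x] <-].
by exists x => //; split=> //; apply: le_trans a'x.
Qed.

Arguments beta_le {R n X phi rew a a'} _.

(** Two optimisations in a row: [x] minimises risk at reward level [a], then [y] maximises reward
    within the risk budget [phi x]. Since [x] fits that budget, [y] earns at least [a]. *)
Lemma frontier_point (R : realType) (n : nat) (X : set 'rV[R]_n)
    (phi rew : 'rV[R]_n -> R) (a : R) :
  X !=set0 -> optima_attained X phi rew -> a <= max_reward X rew ->
  exists y, [/\ a <= rew y, rew y <= max_reward X rew,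
    beta X phi rew (rew y) = beta X phi rew a
    & alpha X phi rew (fine (beta X phi rew a)) = (rew y)%:E].
Proof.
move=> X0 [beta_att alpha_att _ /(_ X0) [z Xz z_max]].
have maxE : max_reward X rew = rew z by apply: sup_attained.
rewrite maxE => le_az.
(* The reward maximiser [z] makes level [a] feasible, so [beta] is finite there and [fine] loses
   nothing. *)
have [x [Xx le_ax] x_min] : attains_min phi (reward_feasible X rew a).
  by apply: beta_att; exists z.
have betaE : beta X phi rew a = (phi x)%:E by apply: ereal_inf_attained.
rewrite betaE /=.
have [y [Xy le_yx] y_max] : attains_max rew (risk_feasible X phi (phi x)).
  by apply: alpha_att; exists x; split.
have le_ay : a <= rew y by apply: le_trans le_ax _; apply: y_max; split.
exists y; split=> //; [exact: z_max | | exact: ereal_sup_attained].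
(* Monotonicity gives one inequality; for the other, [y] is feasible at its own level [rew y] with
   risk at most [phi x]. *)
apply/eqP; rewrite -betaE eq_le (beta_le le_ay) andbT betaE.
apply: (@le_trans _ _ (phi y)%:E); last by rewrite lee_fin.
by apply: ereal_inf_lbound; exists y.
Qed.

Arguments frontier_point {R n X phi rew a} _ _ _.

(* The equivalence fails when I contains its right end point m and m < max_reward
   (strict increase on I says nothing about beta to the right of m), so the
   converse implication carries the proviso that a greatest element of I, if
   there is one, is max_reward. *)
Theorem theorem1 (R : realType) (n : nat) (X : set 'rV[R]_n)
    (phi rew : 'rV[R]_n -> R) (I : set R)
    (X_neq0 : X !=set0) (X_compact : compact X)
    (attained : optima_attained X phi rew)
    (I_interval : is_interval I)
    (I_sub : forall a, I a ->
       (alpha X phi rew (min_risk X phi) <= a%:E)%E /\ a <= max_reward X rew) :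
  (frontier_identity_on X phi rew I ->
     strictly_increasing_on (beta X phi rew) I) /\
  ((forall m, I m -> (forall a, I a -> a <= m) -> m = max_reward X rew) ->
     strictly_increasing_on (beta X phi rew) I ->
     frontier_identity_on X phi rew I).
Proof.
split=> [id_I a a' Ia Ia' lt_aa' | I_max beta_incr a Ia].
  (* The identity recovers each level from its [beta] value, so [beta] is injective on [I]. *)
  rewrite lt_neqAle (beta_le (ltW lt_aa')) andbT; apply/eqP => beta_eq.
  have : a%:E = a'%:E by rewrite (id_I _ Ia) (id_I _ Ia') beta_eq.
  by move=> [eq_aa']; rewrite eq_aa' ltxx in lt_aa'.
have [_ le_a_max] := I_sub _ Ia.
have [y [le_ay le_y_max beta_y ->]] := frontier_point X_neq0 attained le_a_max.
congr (_%:E); apply/eqP; rewrite eq_le le_ay /=.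
case: (pselect (exists2 a', I a' & a < a')) => [[a' Ia' lt_aa'] | a_top].
  rewrite leNgt; apply/negP => lt_ay.
  (* [rew y] may lie outside [I]; capping it at [a'] stays in the interval and in the range where
     [beta] is constant. *)
  have lt_ac : a < Num.min a' (rew y) by rewrite lt_min lt_aa'.
  have Ic : I (Num.min a' (rew y)).
    by apply: (I_interval a a') => //; rewrite (ltW lt_ac) ge_min lexx.
  have := beta_incr _ _ Ia Ic lt_ac; rewrite ltNge -beta_y.
  by rewrite beta_le // ge_min lexx orbT.
(* Here [a] is the greatest element of [I], hence the maximal reward, which bounds [rew y]. *)
rewrite (I_max _ Ia) // => a' Ia'; rewrite leNgt; apply/negP => lt_aa'.
by apply: a_top; exists a'.
Qed.
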